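(* Let $U\in\mathcal{CU}_\mu(\mathcal H)$. Then $b(U)\in\mathcal{SB}(\mathbb N_0)$.
   Context: Let $\mu_j>0$ ($j\in\mathbb N_0=\{0,1,\dots\}$) with $\sum_j\mu_j=1$. $\mathcal H=l^2(\mathbb N_0,\mu)$ is the Hilbert space of complex sequences with $\langle x,y\rangle=\sum_j\mu_jx_j\overline{y_j}$, $\|x\|=\sqrt{\langle x,x\rangle}$. $\mathcal{CU}_\mu(\mathcal H)$ is the set of bounded linear operators $U$ on $\mathcal H$ with $\|Ux\|\le\|x\|$ for all $x\in\mathcal H$. The matrix entries of $U$ are defined by $(Ux)_j=\sum_kU_{jk}x_k$. For $U\in\mathcal{CU}_\mu(\mathcal H)$, $b(U)$ is the operator on $l^1(\mathbb N_0)$ (norm $\sum_j|x_j|$) with matrix entries $b(U)_{jk}=\frac{\mu_j}{\mu_k}|U_{jk}|^2$. $\mathcal{SB}(\mathbb N_0)$ (semibistochastic operators) is the set of operators $\mathbf B:l^1(\mathbb N_0)\to l^1(\mathbb N_0)$, $(\mathbf Bx)_j=\sum_k\mathbf B_{jk}x_k$, with $\mathbf B_{jk}\ge0$ for all $j,k$, $\sum_{j}\mathbf B_{jk}\le1$ for every $k$, and $\sum_{k}\mathbf B_{jk}\le1$ for every $j$. *)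

(* Defs.v *)
From Stdlib Require Import Reals Lra Psatz FunctionalExtensionality ProofIrrelevance.
From Coquelicot Require Import Coquelicot.
Open Scope R_scope.

Record weight := Weight {
  weight_fun :> nat -> R;
  weight_pos : forall j, 0 < weight_fun j;
  weight_sum : is_series weight_fun 1 }.

Lemma series_nonneg_le_eq0 (a : nat -> R) :
  (forall n, 0 <= a n) -> ex_series a -> Series a = 0 -> forall n, a n = 0.
Proof.
intros Ha Hs H0 n.
assert (Hp : forall m, 0 <= Series (fun k => a (m + k)%nat)).
{ intros m; replace 0 with (Series (fun _ : nat => 0 * 0)).
  - apply Series_le; [intros; split; [lra | rewrite Rmult_0_l; apply Ha]|].
    now apply ex_series_incr_n.
  - rewrite Series_scal_l; ring. }
assert (Hs0 : sum_f_R0 a n + Series (fun k => a (S n + k)%nat) = 0).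
{ rewrite <- H0; symmetry; apply (Series_incr_n a (S n)); [apply Nat.lt_0_succ | exact Hs]. }
assert (Hn : a n <= sum_f_R0 a n).
{ destruct n as [|n]; simpl; [lra|].
  assert (0 <= sum_f_R0 a n) by (apply cond_pos_sum; intros; apply Ha). lra. }
specialize (Hp (S n)); specialize (Ha n); lra.
Qed.

Lemma Series_nonneg (a : nat -> R) :
  (forall n, 0 <= a n) -> ex_series a -> 0 <= Series a.
Proof.
intros Ha Hs; replace 0 with (Series (fun n => 0 * a n)).
- apply Series_le; [|exact Hs]; intros n; rewrite Rmult_0_l; split; [lra | apply Ha].
- rewrite Series_scal_l; ring.
Qed.

Lemma ex_series_le_R (a b : nat -> R) :
  (forall n, 0 <= a n <= b n) -> ex_series b -> ex_series a.
Proof.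
intros H; apply (@ex_series_le R_AbsRing R_CompleteNormedModule).
intros n; change (Rabs (a n) <= b n); rewrite Rabs_pos_eq; apply H.
Qed.

Lemma Cmod_plus_sqr_le (t : R) (u v : C) : 0 < t ->
  Cmod (u + v)%C ^ 2 <= (1 + t) * Cmod u ^ 2 + (1 + / t) * Cmod v ^ 2.
Proof.
intros Ht.
assert (H := Cmod_triangle u v); assert (H0 := Cmod_ge_0 (u + v)%C).
assert (H1 : Cmod (u + v)%C ^ 2 <= (Cmod u + Cmod v) ^ 2) by (apply pow_incr; lra).
assert (H2 : (1 + t) * Cmod u ^ 2 + (1 + / t) * Cmod v ^ 2 - (Cmod u + Cmod v) ^ 2
             = / t * (t * Cmod u - Cmod v) ^ 2) by (field; lra).
assert (H3 : 0 <= / t * (t * Cmod u - Cmod v) ^ 2).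
{ apply Rmult_le_pos; [left; now apply Rinv_0_lt_compat | apply pow2_ge_0]. }
lra.
Qed.

Record l2 (mu : weight) := L2 {
  l2_seq :> nat -> C;
  l2_summable : ex_series (fun j => mu j * Cmod (l2_seq j) ^ 2) }.
Arguments L2 {mu} _ _.
Arguments l2_seq {mu} _ _.
Arguments l2_summable {mu} _.

Section L2.
Variable mu : weight.

Lemma l2_ext (x y : l2 mu) : (forall j, x j = y j) -> x = y.
Proof.
destruct x as [x Hx], y as [y Hy]; simpl; intros E.
apply functional_extensionality in E; subst y; f_equal; apply proof_irrelevance.
Qed.

Lemma l2_term_ge0 (x : nat -> C) j : 0 <= mu j * Cmod (x j) ^ 2.
Proof. apply Rmult_le_pos; [left; apply weight_pos | apply pow2_ge_0]. Qed.

Lemma l2_plus_summable (x y : l2 mu) :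
  ex_series (fun j => mu j * Cmod (x j + y j)%C ^ 2).
Proof.
apply ex_series_le_R with
  (fun j => plus (scal 2 (mu j * Cmod (x j) ^ 2)) (scal 2 (mu j * Cmod (y j) ^ 2))).
- intros j; split; [apply (l2_term_ge0 (fun j => (x j + y j)%C))|].
  assert (H := Cmod_plus_sqr_le 1 (x j) (y j) Rlt_0_1); rewrite Rinv_1 in H.
  change (mu j * Cmod (x j + y j)%C ^ 2
          <= 2 * (mu j * Cmod (x j) ^ 2) + 2 * (mu j * Cmod (y j) ^ 2)).
  assert (Hm := weight_pos mu j); nra.
- apply (@ex_series_plus R_AbsRing R_NormedModule);
    apply (@ex_series_scal R_AbsRing R_NormedModule); apply l2_summable.
Qed.

Lemma l2_scal_summable (c : C) (x : l2 mu) :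
  ex_series (fun j => mu j * Cmod (c * x j)%C ^ 2).
Proof.
apply ex_series_ext with (fun j => scal (Cmod c ^ 2) (mu j * Cmod (x j) ^ 2)).
- intros j; rewrite Cmod_mult.
  change (Cmod c ^ 2 * (mu j * Cmod (x j) ^ 2) = mu j * (Cmod c * Cmod (x j)) ^ 2); ring.
- apply (@ex_series_scal R_AbsRing R_NormedModule), l2_summable.
Qed.

Lemma l2_opp_summable (x : l2 mu) : ex_series (fun j => mu j * Cmod (- x j)%C ^ 2).
Proof.
apply ex_series_ext with (fun j => mu j * Cmod (x j) ^ 2).
- intros j; now rewrite Cmod_opp.
- apply l2_summable.
Qed.

Lemma l2_zero_summable : ex_series (fun j => mu j * Cmod 0%C ^ 2).
Proof.
apply ex_series_ext with (fun j => scal 0 (mu j)).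
- intros j; rewrite Cmod_0; change (0 * mu j = mu j * 0 ^ 2); ring.
- apply (@ex_series_scal R_AbsRing R_NormedModule); exists 1; apply weight_sum.
Qed.

Definition l2_plus (x y : l2 mu) : l2 mu := L2 _ (l2_plus_summable x y).
Definition l2_scal (c : C) (x : l2 mu) : l2 mu := L2 _ (l2_scal_summable c x).
Definition l2_opp (x : l2 mu) : l2 mu := L2 _ (l2_opp_summable x).
Definition l2_zero : l2 mu := L2 _ l2_zero_summable.

(* Coquelicot's [Series] is real-valued, so the complex series is summed
   componentwise; [inner_correct] shows that this is its sum in C. *)
Definition inner (x y : l2 mu) : C :=
  (Series (fun j => Re (mu j * (x j * Cconj (y j)))%C),
   Series (fun j => Im (mu j * (x j * Cconj (y j)))%C)).

Definition l2_norm (x : l2 mu) : R := sqrt (Re (inner x x)).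

Lemma inner_term_re (x : C) (m : R) : Re (m * (x * Cconj x))%C = m * Cmod x ^ 2.
Proof. rewrite <- Cmod2_conj, <- RtoC_mult; reflexivity. Qed.

Lemma inner_diag (x : l2 mu) : Re (inner x x) = Series (fun j => mu j * Cmod (x j) ^ 2).
Proof. apply Series_ext; intros j; apply inner_term_re. Qed.

Lemma im_le_Cmod (c : C) : Rabs (Im c) <= Cmod c.
Proof. eapply Rle_trans; [apply Rmax_r | apply Rmax_Cmod]. Qed.

Lemma inner_term_le (x y : l2 mu) j :
  Cmod (mu j * (x j * Cconj (y j)))%C <= mu j * Cmod (x j) ^ 2 + mu j * Cmod (y j) ^ 2.
Proof.
rewrite !Cmod_mult, Cmod_conj, Cmod_R, Rabs_pos_eq by (left; apply weight_pos).
assert (Hm := weight_pos mu j).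
assert (Hx := Cmod_ge_0 (x j)); assert (Hy := Cmod_ge_0 (y j)).
assert (Cmod (x j) * Cmod (y j) <= Cmod (x j) ^ 2 + Cmod (y j) ^ 2)
  by (assert (H := pow2_ge_0 (Cmod (x j) - Cmod (y j))); nra).
nra.
Qed.

Lemma inner_summable (f : C -> R) (Hf : forall c, Rabs (f c) <= Cmod c) (x y : l2 mu) :
  ex_series (fun j => f (mu j * (x j * Cconj (y j)))%C).
Proof.
apply (@ex_series_le R_AbsRing R_CompleteNormedModule) with
  (fun j => mu j * Cmod (x j) ^ 2 + mu j * Cmod (y j) ^ 2).
- intros j; eapply Rle_trans; [apply Hf | apply inner_term_le].
- apply (@ex_series_plus R_AbsRing R_NormedModule); apply l2_summable.
Qed.

Lemma inner_correct (x y : l2 mu) :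
  is_series (fun j => (mu j * (x j * Cconj (y j)))%C) (inner x y).
Proof.
assert (Hre := Series_correct _ (inner_summable Re re_le_Cmod x y)).
assert (Him := Series_correct _ (inner_summable Im im_le_Cmod x y)).
unfold is_series in *.
set (a := fun j => (mu j * (x j * Cconj (y j)))%C) in *.
assert (E : forall n, (sum_n (fun j => Re (a j)) n, sum_n (fun j => Im (a j)) n)
                      = sum_n (G := C_AbelianMonoid) a n).
{ induction n as [|n IH].
  - rewrite !sum_O; now destruct (a 0%nat).
  - rewrite !sum_Sn, <- IH; reflexivity. }
apply filterlim_ext with (1 := E).
intros P [e He]; unfold filtermap.
assert (H1 := Hre _ (locally_ball _ e)); assert (H2 := Him _ (locally_ball _ e)).
unfold filtermap in H1, H2.
generalize (filter_and _ _ H1 H2); apply filter_imp.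
intros n [B1 B2]; apply He; split; assumption.
Qed.

Lemma l2_norm_sqr (x : l2 mu) : l2_norm x ^ 2 = Series (fun j => mu j * Cmod (x j) ^ 2).
Proof.
unfold l2_norm; rewrite inner_diag; apply pow2_sqrt.
apply Series_nonneg; [intros; apply l2_term_ge0 | apply l2_summable].
Qed.

Lemma l2_norm_ge0 (x : l2 mu) : 0 <= l2_norm x.
Proof. apply sqrt_pos. Qed.

Lemma l2_norm_plus (x y : l2 mu) : l2_norm (l2_plus x y) <= l2_norm x + l2_norm y.
Proof.
apply le_epsilon; intros e He.
assert (Hx := l2_norm_ge0 x); assert (Hy := l2_norm_ge0 y).
set (A := l2_norm x + e / 2); set (B := l2_norm y + e / 2).
assert (HA : 0 < A) by (unfold A; lra). assert (HB : 0 < B) by (unfold B; lra).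
assert (Ht : 0 < B / A) by (apply Rdiv_lt_0_compat; assumption).
assert (H : l2_norm (l2_plus x y) ^ 2
            <= (1 + B / A) * l2_norm x ^ 2 + (1 + / (B / A)) * l2_norm y ^ 2).
{ rewrite !l2_norm_sqr, <- !Series_scal_l, <- Series_plus;
    try (apply (@ex_series_scal R_AbsRing R_NormedModule), l2_summable).
  apply Series_le.
  - intros j; split; [apply l2_term_ge0|].
    assert (H := Cmod_plus_sqr_le _ (x j) (y j) Ht).
    simpl l2_seq. assert (Hm := weight_pos mu j); nra.
  - apply (@ex_series_plus R_AbsRing R_NormedModule);
      apply (@ex_series_scal R_AbsRing R_NormedModule); apply l2_summable. }
assert (H1 : l2_norm x ^ 2 <= A ^ 2) by (apply pow_incr; unfold A; lra).
assert (H2 : l2_norm y ^ 2 <= B ^ 2) by (apply pow_incr; unfold B; lra).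
assert (H3 : (1 + B / A) * A ^ 2 + (1 + / (B / A)) * B ^ 2 = (A + B) ^ 2)
  by (field; lra).
assert (H4 : 0 < / (B / A)) by (now apply Rinv_0_lt_compat).
assert (H5 : l2_norm (l2_plus x y) ^ 2 <= (A + B) ^ 2) by nra.
assert (H6 : l2_norm (l2_plus x y) <= A + B).
{ apply Rsqr_incr_0_var; [|lra]; unfold Rsqr; nra. }
unfold A, B in H6; lra.
Qed.

Lemma l2_norm_scal (c : C) (x : l2 mu) : l2_norm (l2_scal c x) <= Cmod c * l2_norm x.
Proof.
right; apply Rsqr_inj; [apply l2_norm_ge0| |].
- apply Rmult_le_pos; [apply Cmod_ge_0 | apply l2_norm_ge0].
- rewrite !Rsqr_pow2, Rpow_mult_distr, !l2_norm_sqr, <- Series_scal_l.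
  apply Series_ext; intros j; simpl l2_seq; rewrite Cmod_mult; ring.
Qed.

Lemma l2_norm_eq0 (x : l2 mu) : l2_norm x = 0 -> x = l2_zero.
Proof.
intros H; apply l2_ext; intros j; simpl.
assert (Hs := l2_norm_sqr x); rewrite H in Hs.
assert (Hj : mu j * Cmod (x j) ^ 2 = 0).
{ apply (series_nonneg_le_eq0 (fun j => mu j * Cmod (x j) ^ 2)).
  - intros; apply l2_term_ge0.
  - apply l2_summable.
  - rewrite <- Hs; ring. }
assert (Hm := weight_pos mu j).
apply Cmod_eq_0; apply Rmult_integral in Hj; destruct Hj as [Hj|Hj]; [lra|].
destruct (Req_dec (Cmod (x j)) 0) as [E|E]; [exact E|].
now apply (pow_nonzero _ 2) in E.
Qed.

Lemma l2_norm_zero : l2_norm l2_zero = 0.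
Proof.
apply Rle_antisym; [|apply l2_norm_ge0].
replace l2_zero with (l2_scal 0 l2_zero) by (apply l2_ext; intros j; simpl; ring).
eapply Rle_trans; [apply l2_norm_scal | rewrite Cmod_0; lra].
Qed.

Lemma l2_norm_opp (x : l2 mu) : l2_norm (l2_opp x) = l2_norm x.
Proof.
unfold l2_norm; rewrite !inner_diag; f_equal; apply Series_ext.
intros j; simpl l2_seq; now rewrite Cmod_opp.
Qed.

Definition l2_AbelianMonoid_mixin : AbelianMonoid.mixin_of (l2 mu).
Proof.
apply (AbelianMonoid.Mixin _ l2_plus l2_zero);
  intros; apply l2_ext; intros j; simpl; ring.
Defined.

Canonical l2_AbelianMonoid :=
  AbelianMonoid.Pack (l2 mu) l2_AbelianMonoid_mixin (l2 mu).

Definition l2_AbelianGroup_mixin : AbelianGroup.mixin_of l2_AbelianMonoid.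
Proof.
apply (AbelianGroup.Mixin _ l2_opp); intros; apply l2_ext; intros j; simpl; ring.
Defined.

Canonical l2_AbelianGroup := AbelianGroup.Pack (l2 mu)
  (AbelianGroup.Class _ l2_AbelianMonoid_mixin l2_AbelianGroup_mixin) (l2 mu).

Definition l2_ModuleSpace_mixin : ModuleSpace.mixin_of C_Ring l2_AbelianGroup.
Proof.
apply (ModuleSpace.Mixin _ _ l2_scal); intros; apply l2_ext; intros j;
  simpl; unfold mult, one, plus; simpl; ring.
Defined.

Definition l2_ModuleSpace_class :=
  ModuleSpace.Class C_Ring (l2 mu) (AbelianGroup.Class _ _ l2_AbelianGroup_mixin)
    l2_ModuleSpace_mixin.

Canonical l2_ModuleSpace := ModuleSpace.Pack C_Ring (l2 mu) l2_ModuleSpace_class (l2 mu).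

Definition l2_UniformSpace_mixin : UniformSpace.mixin_of (l2 mu).
Proof.
apply (UniformSpace.Mixin _ l2_zero (fun x e y => l2_norm (minus y x) < e)).
- intros x e; rewrite minus_eq_zero.
  change (l2_norm l2_zero < e); rewrite l2_norm_zero; apply cond_pos.
- intros x y e H; rewrite <- opp_minus.
  change (l2_norm (l2_opp (minus y x)) < e); rewrite l2_norm_opp; exact H.
- intros x y z e1 e2 H1 H2; rewrite (minus_trans y).
  eapply Rle_lt_trans; [apply l2_norm_plus | lra].
Defined.

Canonical l2_UniformSpace := UniformSpace.Pack (l2 mu) l2_UniformSpace_mixin (l2 mu).

Canonical l2_NormedModuleAux := NormedModuleAux.Pack C_AbsRing (l2 mu)
  (NormedModuleAux.Class C_AbsRing _ l2_ModuleSpace_class l2_UniformSpace_mixin) (l2 mu).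

Definition l2_NormedModule_mixin : NormedModule.mixin_of C_AbsRing l2_NormedModuleAux.
Proof.
apply (NormedModule.Mixin _ _ l2_norm 1).
- exact l2_norm_plus.
- exact l2_norm_scal.
- intros x y e H; exact H.
- intros x y e H; rewrite Rmult_1_l; exact H.
- exact l2_norm_eq0.
Defined.

Canonical l2_NormedModule := NormedModule.Pack C_AbsRing (l2 mu)
  (NormedModule.Class C_AbsRing _ (NormedModuleAux.Class C_AbsRing _ _ l2_UniformSpace_mixin)
     l2_NormedModule_mixin) (l2 mu).

End L2.

(* Complex scalars; operators with real entries restrict to real l^1. *)
Record l1 := L1 {
  l1_seq :> nat -> C;
  l1_summable : ex_series (fun j => Cmod (l1_seq j)) }.

Lemma l1_ext (x y : l1) : (forall j, x j = y j) -> x = y.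
Proof.
destruct x as [x Hx], y as [y Hy]; simpl; intros E.
apply functional_extensionality in E; subst y; f_equal; apply proof_irrelevance.
Qed.

Lemma l1_plus_summable (x y : l1) : ex_series (fun j => Cmod (x j + y j)%C).
Proof.
apply ex_series_le_R with (fun j => plus (Cmod (x j)) (Cmod (y j))).
- intros j; split; [apply Cmod_ge_0 | apply Cmod_triangle].
- apply (@ex_series_plus R_AbsRing R_NormedModule); apply l1_summable.
Qed.

Lemma l1_scal_summable (c : C) (x : l1) : ex_series (fun j => Cmod (c * x j)%C).
Proof.
apply ex_series_ext with (fun j => scal (Cmod c) (Cmod (x j))).
- intros j; now rewrite Cmod_mult.
- apply (@ex_series_scal R_AbsRing R_NormedModule), l1_summable.
Qed.

Lemma l1_opp_summable (x : l1) : ex_series (fun j => Cmod (- x j)%C).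
Proof.
apply ex_series_ext with (fun j => Cmod (x j)).
- intros j; now rewrite Cmod_opp.
- apply l1_summable.
Qed.

Lemma l1_zero_summable : ex_series (fun _ : nat => Cmod 0%C).
Proof.
exists 0; apply is_series_ext with (fun _ => scal 0 0).
- intros; rewrite Cmod_0; apply Rmult_0_l.
- apply filterlim_ext with (fun _ : nat => 0); [|apply filterlim_const].
  intros n; rewrite sum_n_const; change (0 = INR (S n) * (0 * 0)); ring.
Qed.

Definition l1_plus (x y : l1) : l1 := L1 _ (l1_plus_summable x y).
Definition l1_scal (c : C) (x : l1) : l1 := L1 _ (l1_scal_summable c x).
Definition l1_opp (x : l1) : l1 := L1 _ (l1_opp_summable x).
Definition l1_zero : l1 := L1 _ l1_zero_summable.

Definition l1_norm (x : l1) : R := Series (fun j => Cmod (x j)).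

Lemma l1_norm_ge0 (x : l1) : 0 <= l1_norm x.
Proof. apply Series_nonneg; [intros; apply Cmod_ge_0 | apply l1_summable]. Qed.

Lemma l1_norm_plus (x y : l1) : l1_norm (l1_plus x y) <= l1_norm x + l1_norm y.
Proof.
unfold l1_norm; rewrite <- Series_plus by apply l1_summable.
apply Series_le.
- intros j; split; [apply Cmod_ge_0 | apply Cmod_triangle].
- apply (@ex_series_plus R_AbsRing R_NormedModule); apply l1_summable.
Qed.

Lemma l1_norm_scal (c : C) (x : l1) : l1_norm (l1_scal c x) <= Cmod c * l1_norm x.
Proof.
unfold l1_norm; rewrite <- Series_scal_l; right.
apply Series_ext; intros j; apply Cmod_mult.
Qed.

Lemma l1_norm_eq0 (x : l1) : l1_norm x = 0 -> x = l1_zero.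
Proof.
intros H; apply l1_ext; intros j; apply Cmod_eq_0.
apply (series_nonneg_le_eq0 (fun j => Cmod (x j))); trivial.
- intros; apply Cmod_ge_0.
- apply l1_summable.
Qed.

Lemma l1_norm_zero : l1_norm l1_zero = 0.
Proof.
apply Rle_antisym; [|apply l1_norm_ge0].
replace l1_zero with (l1_scal 0 l1_zero) by (apply l1_ext; intros j; simpl; ring).
eapply Rle_trans; [apply l1_norm_scal | rewrite Cmod_0; lra].
Qed.

Lemma l1_norm_opp (x : l1) : l1_norm (l1_opp x) = l1_norm x.
Proof. apply Series_ext; intros j; apply Cmod_opp. Qed.

Definition l1_AbelianMonoid_mixin : AbelianMonoid.mixin_of l1.
Proof.
apply (AbelianMonoid.Mixin _ l1_plus l1_zero);
  intros; apply l1_ext; intros j; simpl; ring.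
Defined.

Canonical l1_AbelianMonoid := AbelianMonoid.Pack l1 l1_AbelianMonoid_mixin l1.

Definition l1_AbelianGroup_mixin : AbelianGroup.mixin_of l1_AbelianMonoid.
Proof.
apply (AbelianGroup.Mixin _ l1_opp); intros; apply l1_ext; intros j; simpl; ring.
Defined.

Canonical l1_AbelianGroup := AbelianGroup.Pack l1
  (AbelianGroup.Class _ l1_AbelianMonoid_mixin l1_AbelianGroup_mixin) l1.

Definition l1_ModuleSpace_mixin : ModuleSpace.mixin_of C_Ring l1_AbelianGroup.
Proof.
apply (ModuleSpace.Mixin _ _ l1_scal); intros; apply l1_ext; intros j;
  simpl; unfold mult, one, plus; simpl; ring.
Defined.

Definition l1_ModuleSpace_class :=
  ModuleSpace.Class C_Ring l1 (AbelianGroup.Class _ _ l1_AbelianGroup_mixin)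
    l1_ModuleSpace_mixin.

Canonical l1_ModuleSpace := ModuleSpace.Pack C_Ring l1 l1_ModuleSpace_class l1.

Definition l1_UniformSpace_mixin : UniformSpace.mixin_of l1.
Proof.
apply (UniformSpace.Mixin _ l1_zero (fun x e y => l1_norm (minus y x) < e)).
- intros x e; rewrite minus_eq_zero.
  change (l1_norm l1_zero < e); rewrite l1_norm_zero; apply cond_pos.
- intros x y e H; rewrite <- opp_minus.
  change (l1_norm (l1_opp (minus y x)) < e); rewrite l1_norm_opp; exact H.
- intros x y z e1 e2 H1 H2; rewrite (minus_trans y).
  eapply Rle_lt_trans; [apply l1_norm_plus | lra].
Defined.

Canonical l1_UniformSpace := UniformSpace.Pack l1 l1_UniformSpace_mixin l1.

Canonical l1_NormedModuleAux := NormedModuleAux.Pack C_AbsRing l1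
  (NormedModuleAux.Class C_AbsRing _ l1_ModuleSpace_class l1_UniformSpace_mixin) l1.

Definition l1_NormedModule_mixin : NormedModule.mixin_of C_AbsRing l1_NormedModuleAux.
Proof.
apply (NormedModule.Mixin _ _ l1_norm 1).
- exact l1_norm_plus.
- exact l1_norm_scal.
- intros x y e H; exact H.
- intros x y e H; rewrite Rmult_1_l; exact H.
- exact l1_norm_eq0.
Defined.

Canonical l1_NormedModule := NormedModule.Pack C_AbsRing l1
  (NormedModule.Class C_AbsRing _ (NormedModuleAux.Class C_AbsRing _ _ l1_UniformSpace_mixin)
     l1_NormedModule_mixin) l1.

(* [is_linear] is Coquelicot's predicate of bounded linear maps. *)
Definition CU (mu : weight) (U : l2 mu -> l2 mu) : Prop :=
  is_linear U /\ forall x : l2 mu, norm (U x) <= norm x.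

(* The matrix of an operator on a space [V] of sequences is determined by the
   operator as soon as every finitely supported sequence belongs to [V]. *)
Definition has_matrix {V : Type} (coord : V -> nat -> C)
    (T : V -> V) (M : nat -> nat -> C) : Prop :=
  forall (x : V) (j : nat),
    is_series (fun k => (M j k * coord x k)%C) (coord (T x) j).

(* [B] is the operator b(U): the entries of [U] are the [u] given by
   (U x)_j = sum_k u_jk x_k, and [B] maps l^1 boundedly into itself.  That such
   a [B] exists is not part of the definition. *)
Definition is_b (mu : weight) (U : l2 mu -> l2 mu) (B : l1 -> l1) : Prop :=
  is_linear B /\
  exists u : nat -> nat -> C,
    has_matrix l2_seq U u /\
    has_matrix l1_seq B (fun j k => RtoC (mu j / mu k * Cmod (u j k) ^ 2)).

(* The entries [M] are determined by [B]; real-valuedness of [M] is part of the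
   nonnegativity condition. *)
Definition SB (B : l1 -> l1) : Prop :=
  is_linear B /\
  exists M : nat -> nat -> R,
    has_matrix l1_seq B (fun j k => RtoC (M j k)) /\
    (forall j k, 0 <= M j k) /\
    (forall k, ex_series (fun j => M j k) /\ Series (fun j => M j k) <= 1) /\
    (forall j, ex_series (fun k => M j k) /\ Series (fun k => M j k) <= 1).

(* Main.v *)
(* The k-th column of b(U) sums to ||U e_k||^2 / ||e_k||^2.  For the j-th row,
   put s = sum_(k <= n) |U_jk|^2 / mu_k and let x be the vector with entries
   conj(U_jk) / mu_k for k <= n; then (Ux)_j = s and ||x||^2 = s, so that
   mu_j s^2 <= ||Ux||^2 <= s and mu_j s <= 1. *)
Require Import Defs.
From Stdlib Require Import Reals Lra Lia FunctionalExtensionality.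
From Coquelicot Require Import Coquelicot.
Open Scope R_scope.

(** * Finite sums, nonnegative series and complex series *)

Lemma sum_n_delta {G : AbelianMonoid} (a : nat -> G) (k n : nat) :
  sum_n (fun j => if Nat.eqb j k then a j else zero) n =
  if Nat.leb k n then a k else zero.
Proof.
induction n as [|n IH].
- rewrite sum_O; now destruct k.
- rewrite sum_Sn, IH; clear IH.
  destruct (Nat.eqb_spec (S n) k) as [E|E].
  + subst k; replace (Nat.leb (S n) n) with false
      by (symmetry; apply Nat.leb_gt; lia).
    rewrite Nat.leb_refl; apply plus_zero_l.
  + rewrite plus_zero_r.
    destruct (Nat.leb_spec k n), (Nat.leb_spec k (S n)); trivial; lia.
Qed.

Lemma sum_n_support {G : AbelianMonoid} (a : nat -> G) (n m : nat) :
  (forall k, (n < k)%nat -> a k = zero) -> (n <= m)%nat -> sum_n a m = sum_n a n.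
Proof.
intros Ha Hm; induction Hm as [|m Hm IH]; [reflexivity|].
rewrite sum_Sn, IH, Ha by lia; apply plus_zero_r.
Qed.

(** The partial sums are constant from index n on. *)
Lemma is_series_finite {K : AbsRing} {V : NormedModule K} (a : nat -> V) (n : nat) :
  (forall k, (n < k)%nat -> a k = zero) -> is_series a (sum_n a n).
Proof.
intros Ha; apply filterlim_ext_loc with (fun _ : nat => sum_n a n).
- exists n; intros m Hm; symmetry; now apply sum_n_support.
- apply filterlim_const.
Qed.

Lemma sum_n_le_of_is_series (a : nat -> R) (l : R) (n : nat) :
  (forall k, 0 <= a k) -> is_series a l -> sum_n a n <= l.
Proof.
intros Ha Hl; apply (is_lim_seq_incr_compare (sum_n a) l); [exact Hl|].
intros m; rewrite sum_Sn; specialize (Ha (S m)).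
change (sum_n a m <= sum_n a m + a (S m)); lra.
Qed.

Lemma series_term_le (a : nat -> R) (j : nat) :
  (forall k, 0 <= a k) -> ex_series a -> a j <= Series a.
Proof.
intros Ha Hs; eapply Rle_trans; [|apply (sum_n_le_of_is_series a _ j Ha)].
- destruct j as [|j]; [rewrite sum_O; lra|].
  rewrite sum_Sn, sum_n_Reals; change (a (S j) <= sum_f_R0 a j + a (S j)).
  assert (0 <= sum_f_R0 a j) by (apply cond_pos_sum, Ha); lra.
- now apply Series_correct.
Qed.

(** Monotone convergence: the partial sums increase. It serves for the row sums of b(U) and for the
    l^1 bound on a matrix image. *)
Lemma series_of_bounded_sums (a : nat -> R) (M : R) :
  (forall k, 0 <= a k) -> (forall n, sum_n a n <= M) ->
  ex_series a /\ Series a <= M.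
Proof.
intros Ha Hb.
assert (Hs : ex_series a).
{ destruct (ex_finite_lim_seq_incr (sum_n a) M) as [l Hl].
  - intros n; rewrite sum_Sn; specialize (Ha (S n)).
    change (sum_n a n <= sum_n a n + a (S n)); lra.
  - exact Hb.
  - exists l; exact Hl. }
split; [exact Hs|].
apply (is_lim_seq_le (sum_n a) (fun _ => M) (Series a) M Hb).
- exact (Series_correct _ Hs).
- apply is_lim_seq_const.
Qed.

Lemma is_series_C_intro (a : nat -> C) (l : C) :
  is_series (fun k => Re (a k)) (Re l) -> is_series (fun k => Im (a k)) (Im l) ->
  is_series a l.
Proof.
intros Hre Him; unfold is_series in *.
assert (E : forall n, (sum_n (fun j => Re (a j)) n, sum_n (fun j => Im (a j)) n)
                      = sum_n (G := C_AbelianMonoid) a n).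
{ induction n as [|n IH].
  - rewrite !sum_O; now destruct (a 0%nat).
  - rewrite !sum_Sn, <- IH; reflexivity. }
apply filterlim_ext with (1 := E).
intros P [e He]; unfold filtermap.
assert (H1 := Hre _ (locally_ball _ e)); assert (H2 := Him _ (locally_ball _ e)).
unfold filtermap in H1, H2.
generalize (filter_and _ _ H1 H2); apply filter_imp.
intros n [B1 B2]; apply He; split; assumption.
Qed.

Lemma is_series_C_unique (a : nat -> C) (l l' : C) :
  is_series a l -> is_series a l' -> l = l'.
Proof. intros H H'; exact (filterlim_locally_unique _ _ _ H H'). Qed.

(** The error is squared because the bounds at hand in l^2 are squared norms of tails. *)
Lemma is_series_C_of_sqr_error (a : nat -> C) (l : C) (e : nat -> R) :
  (forall n, Cmod (sum_n a n - l)%C ^ 2 <= e n) -> is_lim_seq e 0 -> is_series a l.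
Proof.
intros Hle He; apply filterlim_locally; intros eps.
(* Once [e n] is below [eps ^ 2], the modulus itself is below [eps]. *)
assert (H2 : 0 < eps ^ 2) by (apply pow_lt, cond_pos).
generalize (He _ (locally_ball 0 (mkposreal _ H2))); unfold filtermap.
apply filter_imp; intros n Hn.
change (Rabs (e n - 0) < eps ^ 2) in Hn.
assert (Hc : Cmod (sum_n a n - l)%C < eps).
{ assert (H := Rle_abs (e n - 0)); specialize (Hle n).
  assert (Hp := cond_pos eps).
  destruct (Rlt_or_le (Cmod (sum_n a n - l)%C) eps) as [H'|H']; [exact H'|].
  assert (eps ^ 2 <= Cmod (sum_n a n - l)%C ^ 2) by (apply pow_incr; lra); lra. }
(* Balls in C are products of real balls, and the modulus dominates both components. *)
split.
- change (Rabs (Re (sum_n a n - l)%C) < eps).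
  eapply Rle_lt_trans; [apply re_le_Cmod | exact Hc].
- change (Rabs (Im (sum_n a n - l)%C) < eps).
  eapply Rle_lt_trans; [apply im_le_Cmod | exact Hc].
Qed.

Lemma sum_n_RtoC (a : nat -> R) (n : nat) :
  sum_n (fun k => RtoC (a k)) n = RtoC (sum_n a n).
Proof.
induction n as [|n IH]; [now rewrite !sum_O|].
rewrite !sum_Sn, IH; symmetry; apply RtoC_plus.
Qed.

(** * Truncated vectors and the matrix of a contraction on l^2 *)

Section Matrix_of_contraction.
Variable mu : weight.

Lemma l2_unit_summable (k : nat) :
  ex_series (fun j => mu j * Cmod (if Nat.eqb j k then RtoC 1 else RtoC 0) ^ 2).
Proof.
eexists; apply (is_series_finite (V := R_NormedModule) _ k).
intros j Hj; replace (Nat.eqb j k) with false by (symmetry; apply Nat.eqb_neq; lia).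
rewrite Cmod_0; change (mu j * 0 ^ 2 = 0); ring.
Qed.

Definition l2_unit (k : nat) : l2 mu := L2 _ (l2_unit_summable k).

(** This is the truncation of [c] after index n, written as a combination of unit vectors so that
    linearity of an operator applies to it directly. *)
Definition l2_comb (c : nat -> C) (n : nat) : l2 mu :=
  sum_n (fun k => scal (c k) (l2_unit k)) n.

Lemma l2_sum_coord (f : nat -> l2 mu) (n j : nat) :
  l2_seq (sum_n f n) j = sum_n (fun k => l2_seq (f k) j) n.
Proof.
induction n as [|n IH]; [now rewrite !sum_O|].
now rewrite !sum_Sn, <- IH.
Qed.

Lemma l2_comb_coord (c : nat -> C) (n j : nat) :
  l2_seq (l2_comb c n) j = if Nat.leb j n then c j else RtoC 0.
Proof.
unfold l2_comb; rewrite l2_sum_coord.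
etransitivity; [|exact (sum_n_delta (G := C_AbelianMonoid) c j n)].
apply sum_n_ext; intros k; rewrite Nat.eqb_sym.
change (c k * (if Nat.eqb j k then RtoC 1 else RtoC 0)
        = if Nat.eqb j k then c k else RtoC 0)%C.
destruct (Nat.eqb j k); ring.
Qed.

Lemma linear_l2_comb_coord (U : l2 mu -> l2 mu) (c : nat -> C) (n j : nat) :
  is_linear U ->
  l2_seq (U (l2_comb c n)) j = sum_n (fun k => (c k * l2_seq (U (l2_unit k)) j)%C) n.
Proof.
intros HU; unfold l2_comb; induction n as [|n IH].
- rewrite !sum_O, (linear_scal U HU); reflexivity.
- rewrite !sum_Sn, (linear_plus U HU), (linear_scal U HU), <- IH; reflexivity.
Qed.

Lemma l2_coord_le (x : l2 mu) (j : nat) : mu j * Cmod (x j) ^ 2 <= l2_norm mu x ^ 2.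
Proof.
rewrite l2_norm_sqr.
apply (series_term_le (fun j => mu j * Cmod (x j) ^ 2)).
- intros k; apply l2_term_ge0.
- apply l2_summable.
Qed.

Lemma l2_norm_comb_sqr (c : nat -> C) (n : nat) :
  l2_norm mu (l2_comb c n) ^ 2 = sum_n (fun k => mu k * Cmod (c k) ^ 2) n.
Proof.
rewrite l2_norm_sqr; apply is_series_unique.
replace (sum_n (fun k => mu k * Cmod (c k) ^ 2) n)
  with (sum_n (fun k => mu k * Cmod (l2_seq (l2_comb c n) k) ^ 2) n).
- apply (is_series_finite (V := R_NormedModule)); intros k Hk.
  rewrite l2_comb_coord.
  replace (Nat.leb k n) with false by (symmetry; apply Nat.leb_gt; lia).
  rewrite Cmod_0; change (mu k * 0 ^ 2 = 0); ring.
- apply sum_n_ext_loc; intros k Hk; rewrite l2_comb_coord.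
  now replace (Nat.leb k n) with true by (symmetry; apply Nat.leb_le; lia).
Qed.

Lemma l2_norm_unit_sqr (k : nat) : l2_norm mu (l2_unit k) ^ 2 = mu k.
Proof.
rewrite l2_norm_sqr; apply is_series_unique.
replace (mu k) with (sum_n (fun j => mu j * Cmod (l2_seq (l2_unit k) j) ^ 2) k).
- apply (is_series_finite (V := R_NormedModule)); intros j Hj; simpl.
  replace (Nat.eqb j k) with false by (symmetry; apply Nat.eqb_neq; lia).
  rewrite Cmod_0; change (mu j * (0 * (0 * 1)) = 0); ring.
- transitivity (if Nat.leb k k then mu k else 0); [|now rewrite Nat.leb_refl].
  etransitivity; [|exact (sum_n_delta (G := R_AbelianMonoid) mu k k)].
  apply sum_n_ext; intros j; simpl; destruct (Nat.eqb j k).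
  + rewrite Cmod_1; ring.
  + rewrite Cmod_0; change (mu j * (0 * (0 * 1)) = 0); ring.
Qed.

(** Pythagoras for disjoint supports: in each coordinate the truncation either equals [x] or
    vanishes, so the squared modulus of the difference is the difference of the squared moduli. *)
Lemma l2_tail_sqr (x : l2 mu) (n : nat) :
  l2_norm mu (minus (l2_comb x n) x) ^ 2 =
  Series (fun k => mu k * Cmod (x k) ^ 2) - sum_n (fun k => mu k * Cmod (x k) ^ 2) n.
Proof.
set (a := fun k => mu k * Cmod (x k) ^ 2).
set (b := fun k => mu k * Cmod (l2_seq (l2_comb x n) k) ^ 2).
rewrite l2_norm_sqr; apply is_series_unique.
assert (Ha : is_series a (Series a)) by apply Series_correct, l2_summable.
assert (Hb : is_series b (sum_n a n)).
{ unfold a; rewrite <- l2_norm_comb_sqr, l2_norm_sqr.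
  apply Series_correct, (l2_summable (l2_comb x n)). }
apply is_series_ext with (2 := is_series_minus _ _ _ _ Ha Hb).
intros k; unfold a, b.
change (mu k * Cmod (x k) ^ 2 + - (mu k * Cmod (l2_seq (l2_comb x n) k) ^ 2) =
        mu k * Cmod (l2_seq (l2_comb x n) k + - x k)%C ^ 2).
rewrite l2_comb_coord; destruct (Nat.leb k n).
- replace (x k + - x k)%C with (RtoC 0) by ring; rewrite Cmod_0; ring.
- replace (RtoC 0 + - x k)%C with (- x k)%C by ring; rewrite Cmod_opp, Cmod_0; ring.
Qed.

Variable U : l2 mu -> l2 mu.
Hypothesis HU : CU mu U.

Definition entry (j k : nat) : C := l2_seq (U (l2_unit k)) j.

Lemma CU_norm_sqr (x : l2 mu) : l2_norm mu (U x) ^ 2 <= l2_norm mu x ^ 2.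
Proof. apply pow_incr; split; [apply l2_norm_ge0 | apply HU]. Qed.

(** Truncations of [x] converge to [x] in norm, the contraction carries this over to their images,
    and each coordinate depends continuously on the vector. *)
Lemma CU_has_matrix : has_matrix l2_seq U entry.
Proof.
intros x j; assert (Hm := weight_pos mu j).
set (a := fun k => mu k * Cmod (x k) ^ 2).
apply is_series_C_of_sqr_error with (fun n => / mu j * (Series a - sum_n a n)).
- intros n; apply Rmult_le_reg_l with (mu j); [exact Hm|].
  rewrite <- Rmult_assoc, Rinv_r, Rmult_1_l by lra.
  unfold a; rewrite <- l2_tail_sqr.
  eapply Rle_trans; [|apply CU_norm_sqr].
  (* By linearity, the error of the n-th partial sum is a coordinate of the image of the tail. *)
  assert (E : (sum_n (fun k => entry j k * x k)%C n - l2_seq (U x) j)%C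
              = l2_seq (U (minus (l2_comb x n) x)) j).
  { unfold minus; rewrite (linear_plus U (proj1 HU)), (linear_opp U _ (proj1 HU)).
    change ((sum_n (fun k => entry j k * x k)%C n - l2_seq (U x) j)%C
            = (l2_seq (U (l2_comb x n)) j + - l2_seq (U x) j)%C).
    rewrite (linear_l2_comb_coord U x n j (proj1 HU)); unfold Cminus; f_equal.
    apply sum_n_ext; intros k; apply Cmult_comm. }
  rewrite E; apply l2_coord_le.
(* The limit 0 is rewritten in the shape that the limit rules for multiples and differences
   produce. *)
- replace (Finite 0) with (Rbar_mult (/ mu j) (Series a - Series a))
    by (simpl; f_equal; ring).
  apply is_lim_seq_scal_l.
  apply is_lim_seq_minus'; [apply is_lim_seq_const|].
  apply (Series_correct a), l2_summable.
Qed.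

(** Applied to a unit vector, the row series keeps a single term. This makes b(U) independent of the
    choice of matrix for [U]. *)
Lemma has_matrix_entry (u : nat -> nat -> C) :
  has_matrix l2_seq U u -> forall j k, u j k = entry j k.
Proof.
intros Hu j k; apply is_series_C_unique with (2 := Hu (l2_unit k) j).
assert (E : u j k = sum_n (fun i => u j i * l2_seq (l2_unit k) i)%C k).
{ transitivity (if Nat.leb k k then u j k else RtoC 0); [now rewrite Nat.leb_refl|].
  etransitivity; [symmetry; exact (sum_n_delta (G := C_AbelianMonoid) (u j) k k)|].
  apply sum_n_ext; intros i; simpl; destruct (Nat.eqb i k).
  - now rewrite Cmult_1_r.
  - now rewrite Cmult_0_r. }
rewrite E; apply (is_series_finite (V := C_NormedModule)); intros i Hi; simpl.
replace (Nat.eqb i k) with false by (symmetry; apply Nat.eqb_neq; lia).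
apply Cmult_0_r.
Qed.

(** * Column and row sums of b(U) *)

Definition b_entry (j k : nat) : R := mu j / mu k * Cmod (entry j k) ^ 2.

Lemma b_entry_ge0 (j k : nat) : 0 <= b_entry j k.
Proof.
apply Rmult_le_pos; [|apply pow2_ge_0].
left; apply Rdiv_lt_0_compat; apply weight_pos.
Qed.

Lemma b_entry_col (k : nat) :
  ex_series (fun j => b_entry j k) /\ Series (fun j => b_entry j k) <= 1.
Proof.
assert (Hk := weight_pos mu k).
assert (E : forall j, / mu k * (mu j * Cmod (entry j k) ^ 2) = b_entry j k)
  by (intros j; unfold b_entry; field; lra).
split.
- apply ex_series_ext with (1 := E).
  apply (@ex_series_scal R_AbsRing R_NormedModule), (l2_summable (U (l2_unit k))).
- rewrite <- (Series_ext _ _ E), Series_scal_l.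
  assert (H := CU_norm_sqr (l2_unit k)); rewrite l2_norm_unit_sqr, l2_norm_sqr in H.
  apply Rmult_le_reg_l with (mu k); [exact Hk|].
  rewrite <- Rmult_assoc, Rinv_r, Rmult_1_l, Rmult_1_r by lra; exact H.
Qed.

Lemma b_entry_row (j : nat) :
  ex_series (fun k => b_entry j k) /\ Series (fun k => b_entry j k) <= 1.
Proof.
assert (Hj := weight_pos mu j).
apply series_of_bounded_sums; [apply b_entry_ge0|]; intros n.
set (s := sum_n (fun k => / mu k * Cmod (entry j k) ^ 2) n).
(* Up to truncation, [c] represents the functional sending x to (Ux)_j in the weighted inner
   product; the factor 1/mu_k cancels the weight. *)
set (c := fun k => (RtoC (/ mu k) * Cconj (entry j k))%C).
assert (Es : sum_n (fun k => b_entry j k) n = mu j * s).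
{ unfold s; rewrite <- (sum_n_mult_l (K := R_Ring)); apply sum_n_ext.
  intros k; unfold b_entry, Rdiv; apply Rmult_assoc. }
assert (Ec : l2_seq (U (l2_comb c n)) j = RtoC s).
{ rewrite (linear_l2_comb_coord U c n j (proj1 HU)).
  unfold s; rewrite <- sum_n_RtoC; apply sum_n_ext; intros k.
  rewrite RtoC_mult, Cmod2_conj; unfold c, entry.
  rewrite <- Cmult_assoc; apply f_equal, Cmult_comm. }
assert (En : l2_norm mu (l2_comb c n) ^ 2 = s).
{ rewrite l2_norm_comb_sqr; apply sum_n_ext; intros k; unfold c.
  assert (Hk := weight_pos mu k).
  rewrite Cmod_mult, Cmod_conj, Cmod_R, Rabs_pos_eq
    by (left; now apply Rinv_0_lt_compat).
  change (mu k * (/ mu k * Cmod (entry j k)) ^ 2 = / mu k * Cmod (entry j k) ^ 2).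
  field; lra. }
assert (H1 := l2_coord_le (U (l2_comb c n)) j).
assert (H2 := CU_norm_sqr (l2_comb c n)).
rewrite Ec, Cmod_R, <- Rsqr_pow2, <- Rsqr_abs, Rsqr_pow2 in H1.
rewrite En in H2; rewrite Es.
assert (0 <= s) by (rewrite <- En; apply pow2_ge_0).
(* From mu_j s^2 <= s: divide by s when s > 0; the case s = 0 is immediate. *)
nra.
Qed.

End Matrix_of_contraction.

(** * Operators on l^1 given by nonnegative matrices with column sums at most 1 *)

Section Semibistochastic.
Variable M : nat -> nat -> R.
Hypothesis M_ge0 : forall j k, 0 <= M j k.
Hypothesis M_col : forall k, ex_series (fun j => M j k) /\ Series (fun j => M j k) <= 1.

Lemma M_le1 (j k : nat) : M j k <= 1.
Proof.
eapply Rle_trans; [|apply (M_col k)].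
apply (series_term_le (fun j => M j k)); [intros; apply M_ge0 | apply M_col].
Qed.

(** Each entry is at most its column sum, hence at most 1, so the terms are dominated by those of
    the l^1 norm of [x]. *)
Lemma mat_abs_summable (x : l1) (j : nat) : ex_series (fun k => M j k * Cmod (x k)).
Proof.
apply ex_series_le_R with (2 := l1_summable x); intros k.
assert (H := M_ge0 j k); assert (H1 := M_le1 j k); assert (H2 := Cmod_ge_0 (x k)).
nra.
Qed.

Lemma mat_part_summable (f : C -> R) (Hf : forall c, Rabs (f c) <= Cmod c) (x : l1) j :
  ex_series (fun k => f (M j k * x k)%C).
Proof.
apply (@ex_series_le R_AbsRing R_CompleteNormedModule) with (2 := mat_abs_summable x j).
intros k; eapply Rle_trans; [apply Hf|].
rewrite Cmod_mult, Cmod_R, Rabs_pos_eq by apply M_ge0; apply Rle_refl.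
Qed.

(** Total on all sequences; for [x] in l^1 it is the genuine sum of the row series, by
    [mat_apply_correct]. *)
Definition mat_apply (x : nat -> C) (j : nat) : C :=
  (Series (fun k => Re (M j k * x k)%C), Series (fun k => Im (M j k * x k)%C)).

Lemma mat_apply_correct (x : l1) (j : nat) :
  is_series (fun k => (M j k * x k)%C) (mat_apply x j).
Proof.
apply is_series_C_intro; apply Series_correct.
- exact (mat_part_summable Re re_le_Cmod x j).
- exact (mat_part_summable Im im_le_Cmod x j).
Qed.

(** The triangle inequality holds for partial sums and passes to the limit by continuity of the
    modulus. *)
Lemma Cmod_mat_apply_le (x : l1) (j : nat) :
  Cmod (mat_apply x j) <= Series (fun k => M j k * Cmod (x k)).
Proof.
assert (Hs := Series_correct _ (mat_abs_summable x j)).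
apply (filterlim_le (F := eventually)
  (fun n => Cmod (sum_n (fun k => (M j k * x k)%C) n))
  (fun n => sum_n (fun k => M j k * Cmod (x k)) n)
  (Finite (Cmod (mat_apply x j))) (Finite (Series (fun k => M j k * Cmod (x k))))).
- exists 0%nat; intros n _; induction n as [|n IH].
  + rewrite !sum_O, Cmod_mult, Cmod_R, Rabs_pos_eq by apply M_ge0; apply Rle_refl.
  + rewrite !sum_Sn; eapply Rle_trans; [apply Cmod_triangle|].
    rewrite Cmod_mult, Cmod_R, Rabs_pos_eq by apply M_ge0.
    apply Rplus_le_compat_r, IH.
- apply (filterlim_comp _ _ _ _ Cmod _ _ _ (mat_apply_correct x j)).
  apply (filterlim_norm (V := C_NormedModule)).
- exact Hs.
Qed.

Lemma mat_apply_l1 (x : l1) :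
  ex_series (fun j => Cmod (mat_apply x j)) /\
  Series (fun j => Cmod (mat_apply x j)) <= l1_norm x.
Proof.
apply series_of_bounded_sums; [intros; apply Cmod_ge_0|]; intros n.
(* Only finitely many rows are summed, so no Fubini argument is needed. *)
assert (Hn : is_series (fun k => sum_n (fun j => M j k) n * Cmod (x k))
               (sum_n (fun j => Series (fun k => M j k * Cmod (x k))) n)).
{ induction n as [|n IH].
  - rewrite sum_O; eapply is_series_ext;
      [|apply Series_correct, (mat_abs_summable x 0%nat)].
    intros k; cbv beta; now rewrite sum_O.
  - rewrite sum_Sn; eapply is_series_ext;
      [|apply (is_series_plus _ _ _ _ IH (Series_correct _ (mat_abs_summable x (S n))))].
    intros k; cbv beta; rewrite sum_Sn; symmetry; apply Rmult_plus_distr_r. }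
apply Rle_trans with (sum_n (fun j => Series (fun k => M j k * Cmod (x k))) n).
- apply sum_n_m_le; intros j; apply Cmod_mat_apply_le.
- rewrite <- (is_series_unique _ _ Hn).
  apply Series_le; [|apply l1_summable]; intros k.
  assert (H1 : sum_n (fun j => M j k) n <= 1).
  { eapply Rle_trans; [|apply (M_col k)].
    apply sum_n_le_of_is_series; [intros; apply M_ge0|].
    apply Series_correct, M_col. }
  assert (H0 : 0 <= sum_n (fun j => M j k) n)
    by (rewrite sum_n_Reals; apply cond_pos_sum; intros; apply M_ge0).
  assert (H2 := Cmod_ge_0 (x k)); nra.
Qed.

Definition mat_op (x : l1) : l1 := L1 (mat_apply x) (proj1 (mat_apply_l1 x)).

Lemma mat_op_has_matrix : has_matrix l1_seq mat_op (fun j k => RtoC (M j k)).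
Proof. exact mat_apply_correct. Qed.

(** Additivity and homogeneity come from uniqueness of sums, both sides being sums of the same row
    series; the l^1 estimate gives the bound 1. *)
Lemma mat_op_linear : is_linear mat_op.
Proof.
split.
- intros x y; apply l1_ext; intros j.
  apply is_series_C_unique with (1 := mat_op_has_matrix (plus x y) j).
  eapply is_series_ext; [|apply (is_series_plus _ _ _ _
    (mat_op_has_matrix x j) (mat_op_has_matrix y j))].
  intros k; symmetry; apply Cmult_plus_distr_l.
- intros c x; apply l1_ext; intros j.
  apply is_series_C_unique with (1 := mat_op_has_matrix (scal c x) j).
  eapply is_series_ext; [|apply (is_series_scal c _ _ (mat_op_has_matrix x j))].
  intros k; change (c * (M j k * x k) = M j k * (c * x k))%C; ring.
- exists 1; split; [lra|]; intros x; rewrite Rmult_1_l; apply mat_apply_l1.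
Qed.

End Semibistochastic.

(** * Uniqueness of b(U) and conclusion *)

Lemma has_matrix_unique (B B' : l1 -> l1) (m : nat -> nat -> C) :
  has_matrix l1_seq B m -> has_matrix l1_seq B' m -> B = B'.
Proof.
intros H H'; apply functional_extensionality; intros x; apply l1_ext; intros j.
exact (is_series_C_unique _ _ _ (H x j) (H' x j)).
Qed.

Theorem lemma3p4 :
  forall (mu : weight) (U : l2 mu -> l2 mu),
    CU mu U ->
    exists B : l1 -> l1, unique (is_b mu U) B /\ SB B.
Proof.
intros mu U HU.
set (M := b_entry mu U).
assert (M_ge0 : forall j k, 0 <= M j k) by apply b_entry_ge0.
assert (M_col := b_entry_col mu U HU).
set (B := mat_op M M_ge0 M_col).
assert (HB : has_matrix l1_seq B (fun j k => RtoC (M j k))) by apply mat_op_has_matrix.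
assert (HL : is_linear B) by apply mat_op_linear.
exists B; split; [split|].
- split; [exact HL|].
  exists (entry mu U); split; [now apply CU_has_matrix | exact HB].
(* A competitor comes with its own matrix [u] of [U]; this must be [entry mu U], so both operators
   have the same matrix on l^1. *)
- intros B' [_ [u [Hu HB']]].
  apply has_matrix_unique with (1 := HB).
  intros x j; eapply is_series_ext; [|exact (HB' x j)].
  intros k; cbv beta; now rewrite (has_matrix_entry mu U u Hu).
- split; [exact HL|].
  exists M; repeat split; try apply M_col; try apply (b_entry_row mu U HU); trivial.
Qed.
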